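(* For all integers $n\ge4$ and $k\ge2$, there are $k$-tuples of self-adjoint matrices $a=(a_1,\dots,a_k),\ b=(b_1,\dots,b_k)\in\mathcal{M}_n^k$ such that $a\prec b$, but there is no mixed unitary quantum channel $\Phi:\mathcal{M}_n\to\mathcal{M}_n$ satisfying $\Phi(b_i)=a_i$ for all $1\le i\le k$.
   Context: Mixed unitary. A unital completely positive map $\Phi:\mathcal{M}_n\to\mathcal{M}_n$ is mixed unitary if there are $l\in\mathbb{N}$, unitaries $u_1,\dots,u_l\in\mathcal{M}_n$ and $t_1,\dots,t_l\in[0,1]$ with $\sum_i t_i=1$ such that $\Phi(x)=\sum_{i=1}^l t_iu_ixu_i^*$ for all $x\in\mathcal{M}_n$. Conventions. Indices $m,n,p\le\infty$ range over $\{1,2,\dots\}\cup\{\infty\}$. For each $n\le\infty$ fix a complex Hilbert space $H_n$ of dimension $n$ ($H_\infty$ of countably infinite dimension). $\mathcal{M}_{m,n}$ is the space of bounded operators $H_n\to H_m$ with the weak* topology (the norm topology if $m,n<\infty$); $\mathcal{M}_n=\mathcal{M}_{n,n}$ with identity $1_n$; $\mathcal{M}=\sqcup_{n\le\infty}\mathcal{M}_n$. $\mathcal{M}_p(\mathcal{M}_n)$ is identified with the bounded operators on $H_p\otimes H_n$, and $\mathcal{M}_p(\mathcal{M})=\sqcup_n\mathcal{M}_p(\mathcal{M}_n)$. The subscript sa denotes self-adjoint elements, the superscript $+$ positive elements, and $\alpha\ge\beta$ means $\alpha-\beta$ is positive. $\mathcal{M}_n^k$ has the product topology, and for $x=(x_1,\dots,x_k)\in\mathcal{M}_n^k$,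 $\alpha x\beta=(\alpha x_1\beta,\dots,\alpha x_k\beta)$. For $n<\infty$, $\mathrm{tr}_n:\mathcal{M}_n\to\mathbb{C}$ is the trace normalized so that $\mathrm{tr}_n(1_n)=1$. Closed nc $k$-ball. For $r>0$, the closed nc $k$-ball of radius $r$ is the graded set $K=\sqcup_{n\le\infty}K_n$ with $K_n=\{x=(x_1,\dots,x_k)\in\mathcal{M}_n^k:\sum_{i=1}^k x_ix_i^*\le r^2 1_n\}$. Multivalued nc functions. Let $K$ be a closed nc $k$-ball and $p\le\infty$. A multivalued nc function $F:K\to\mathcal{M}_p(\mathcal{M})$ assigns to every $n\le\infty$ and $x\in K_n$ a nonempty set $F(x)\subseteq\mathcal{M}_p(\mathcal{M}_n)_{\mathrm{sa}}$ such that $F(\alpha^*x\alpha)=(1_p\otimes\alpha^* )F(x)(1_p\otimes\alpha)$ for every unitary $\alpha\in\mathcal{M}_n$, and $F(x)=F(x)+\mathcal{M}_p(\mathcal{M}_n)^+$. It is bounded if there is $\lambda>0$ such that for every $x\in K$ and $\beta\in F(x)$ there is $\alpha\in F(x)$ with $\alpha\le\beta$ and $\|\alpha\|\le\lambda$. Its graph is $\mathrm{Graph}(F)=\sqcup_n\mathrm{Graph}_n(F)$ with $\mathrm{Graph}_n(F)=\{(x,T):x\in K_n,\ T\in F(x)\}\subseteq K_n\times\mathcal{M}_p(\mathcal{M}_n)$. $F$ is convex if $\mathrm{Graph}(F)$ is an nc convex set, i.e. for every $n\le\infty$, every bounded sequence $(x_i,T_i)\in\mathrm{Graph}_{n_i}(F)$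 and every sequence $\alpha_i\in\mathcal{M}_{n_i,n}$ with $\sum_i\alpha_i^*\alpha_i=1_n$, one has $\big(\sum_i\alpha_i^*x_i\alpha_i,\ \sum_i(1_p\otimes\alpha_i^* )T_i(1_p\otimes\alpha_i)\big)\in\mathrm{Graph}_n(F)$. $F$ is lower semicontinuous if each $\mathrm{Graph}_n(F)$ is closed in $\mathcal{M}_n^k\times\mathcal{M}_p(\mathcal{M}_n)$ (weak* topologies). An nc majorization function is a bounded lower semicontinuous convex multivalued nc function $F:K\to\mathcal{M}_p(\mathcal{M})$, for some $p\le\infty$. Majorization. For $x\in K_n$, $n<\infty$, $(\mathrm{id}_{\mathcal{M}_p}\otimes\mathrm{tr}_n)(F(x))=\{(\mathrm{id}_{\mathcal{M}_p}\otimes\mathrm{tr}_n)(\alpha):\alpha\in F(x)\}$. For two sets $S,T$ of self-adjoint elements, $S\le T$ means that for every $\beta\in T$ there is $\alpha\in S$ with $\alpha\le\beta$. For $k$-tuples of self-adjoint matrices $a,b\in\mathcal{M}_n^k$, $a\prec b$ means $$(\mathrm{id}_{\mathcal{M}_p}\otimes\mathrm{tr}_n)(F(a))\le(\mathrm{id}_{\mathcal{M}_p}\otimes\mathrm{tr}_n)(F(b))$$ for every $p\le\infty$ and every nc majorization function $F:K\to\mathcal{M}_p(\mathcal{M})$, where $K$ is any closed nc $k$-ball containing $a$ and $b$. *)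

(* Defs.v *)
From HB Require Import structures.
From mathcomp Require Import all_boot all_order all_algebra.
From mathcomp Require Import complex lra.
From mathcomp Require Import all_classical all_reals all_analysis.
From mathcomp.analysis.showcase Require Import summability.
Set Implicit Arguments.
Unset Strict Implicit.
Unset Printing Implicit Defensive.
Import Order.TTheory GRing.Theory Num.Theory.
Import numFieldNormedType.Exports.
Local Open Scope classical_set_scope.
Local Open Scope ring_scope.
Local Open Scope complex_scope.

(* The field R[i] packaged as a numClosedFieldType, so that it carries the
   order, norm and topology that the libraries attach to such fields. *)
Definition CC (R : realType) : numClosedFieldType := R[i].

Section Ell2.
Context {R : realType}.
Local Notation C := (CC R).
Implicit Types I J K N P : choiceType.

Definition sqsum I (x : I -> C) : \bar R :=
  \esum_(i in [set: I]) (Normc.normc (x i) ^+ 2)%:E.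

Definition square_summable I : pred (I -> C) :=
  fun x => (sqsum x < +oo)%E.

Lemma sqsum_ge0 I (x : I -> C) : (0 <= sqsum x)%E.
Proof. by apply: esum_ge0 => i _; rewrite lee_fin sqr_ge0. Qed.

Lemma le_esumZ I (c : R) (a : I -> \bar R) : 0 <= c ->
  (forall i, (0 <= a i)%E) ->
  (\esum_(i in [set: I]) (c%:E * a i) <= c%:E * \esum_(i in [set: I]) a i)%E.
Proof.
move=> c0 a0; apply: ge_ereal_sup => _ [A fA <-].
rewrite -ge0_mule_fsumr //; apply: lee_wpmul2l; rewrite ?lee_fin//.
by apply: esum_ge; exists A.
Qed.

Lemma normc_lin (a u v : C) : Normc.normc (a * u + v) ^+ 2 <=
  2 * Normc.normc a ^+ 2 * Normc.normc u ^+ 2 + 2 * Normc.normc v ^+ 2.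
Proof.
have h : Normc.normc (a * u + v) <=
    Normc.normc a * Normc.normc u + Normc.normc v.
  by rewrite -Normc.normcM; exact: le_normcD.
have g0 (z : C) : 0 <= Normc.normc z by case: z => ? ?; exact: sqrtr_ge0.
move: h (g0 (a * u + v)) (g0 a) (g0 u) (g0 v).
move: (Normc.normc (a * u + v)) (Normc.normc a) (Normc.normc u) (Normc.normc v).
move=> s p q t h s0 p0 q0 t0.
have := sqr_ge0 (p * q - t).
have : s ^+ 2 <= (p * q + t) ^+ 2 by rewrite lerXn2r// nnegrE; nra.
nra.
Qed.

Lemma sqsum_lin I (a : C) (x y : I -> C) :
  (sqsum (a *: x + y)%R <=
   (2 * Normc.normc a ^+ 2)%:E * sqsum x + 2%:E * sqsum y)%E.
Proof.
have c0 : 0 <= 2 * Normc.normc a ^+ 2 by rewrite mulr_ge0// sqr_ge0.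
apply: le_trans (leeD (le_esumZ c0 _) (le_esumZ _ _)) => //; last 2 first.
- by move=> i; rewrite lee_fin sqr_ge0.
- by move=> i; rewrite lee_fin sqr_ge0.
rewrite -esumD.
- by apply: le_esum => i _; rewrite -!EFinM -EFinD lee_fin; exact: normc_lin.
- by move=> i _; rewrite -EFinM lee_fin mulr_ge0// sqr_ge0.
- by move=> i _; rewrite -EFinM lee_fin mulr_ge0// sqr_ge0.
Qed.

Lemma sqsum0 I : sqsum (0 : I -> C) = 0%E.
Proof.
apply: esum1 => i _; have -> : Normc.normc ((0 : I -> C) i) = 0.
  exact: Normc.normc0.
by rewrite expr0n.
Qed.

Lemma square_summable_submod I : submod_closed (@square_summable I).
Proof.
split=> [|a x y xs ys]; first by rewrite unfold_in sqsum0.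
rewrite unfold_in (le_lt_trans (sqsum_lin _ _ _))//.
by rewrite lte_add_pinfty// lte_mul_pinfty// ?sqsum_ge0// lee_fin mulr_ge0 ?sqr_ge0.
Qed.

HB.instance Definition _ I :=
  GRing.isSubmodClosed.Build _ _ (@square_summable I)
    (@square_summable_submod I).

Record ell2 I := Ell2 {
  ell2_fun :> I -> C ;
  _ : ell2_fun \in @square_summable I
}.

HB.instance Definition _ I := [isSub for @ell2_fun I].
HB.instance Definition _ I := [Choice of ell2 I by <:].
HB.instance Definition _ I := [SubChoice_isSubLmodule of ell2 I by <:].


(* Linear in the first argument; the sum is the unconditional one, the limit of
   the partial sums over the finite subsets of I ordered by inclusion. *)
Definition inner I (x y : ell2 I) : C :=
  lim (partial_sum (fun i => x i * (y i)^*) @ totally).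

Definition norm2 I (x : ell2 I) : R := Num.sqrt (fine (sqsum x)).

Definition bounded_linear J I : pred (ell2 J -> ell2 I) :=
  fun f => `[< linear f /\
               exists M : R, forall x, norm2 (f x) <= M * norm2 x >].

Lemma sqsum_fin I (x : ell2 I) : (sqsum x < +oo)%E.
Proof. exact: (valP x). Qed.

Lemma sqsum_norm2 I (x : ell2 I) : sqsum x = (norm2 x ^+ 2)%:E.
Proof.
rewrite sqr_sqrtr; last by rewrite fine_ge0// sqsum_ge0.
by rewrite fineK// ge0_fin_numE ?sqsum_ge0// sqsum_fin.
Qed.

Lemma norm2_le I J (M : R) (x : ell2 I) (y : ell2 J) : 0 <= M ->
  (sqsum x <= (M ^+ 2)%:E * sqsum y)%E = (norm2 x <= M * norm2 y).
Proof.
move=> M0; rewrite !sqsum_norm2 -EFinM lee_fin -exprMn ler_pXn2r//.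
- by rewrite nnegrE sqrtr_ge0.
- by rewrite nnegrE mulr_ge0// sqrtr_ge0.
Qed.

Lemma bounded_linearP J I (f : ell2 J -> ell2 I) :
  reflect (linear f /\ exists2 c : R, 0 <= c &
             forall x, (sqsum (f x) <= c%:E * sqsum x)%E)
          (f \in @bounded_linear J I).
Proof.
apply: (iffP (asboolP _)) => -[lf].
  move=> [M hM]; split=> //; exists (M ^+ 2) => [|x]; first exact: sqr_ge0.
  rewrite -real_normK ?num_real// norm2_le//.
  by apply: le_trans (hM x) _; rewrite ler_wpM2r ?sqrtr_ge0// ler_norm.
move=> [c c0 hc]; split=> //; exists (Num.sqrt c) => x.
by rewrite -norm2_le ?sqrtr_ge0// sqr_sqrtr.
Qed.

Lemma bounded_linear_submod J I : submod_closed (@bounded_linear J I).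
Proof.
split=> [|a f g].
  apply/bounded_linearP; split; first by move=> a x y; rewrite scaler0 addr0.
  exists 0 => // x; rewrite mul0e.
  by rewrite (_ : sqsum _ = 0%E)//; exact: sqsum0.
move=> /bounded_linearP[lf [c c0 hc]] /bounded_linearP[lg [d d0 hd]].
apply/bounded_linearP; split.
  move=> b x y; rewrite !fctE lf lg !scalerDr !scalerA [a * b]mulrC.
  by rewrite addrACA.
exists (2 * Normc.normc a ^+ 2 * c + 2 * d) => [|x].
  by apply: addr_ge0; rewrite mulr_ge0// mulr_ge0// sqr_ge0.
apply: le_trans (sqsum_lin a (f x) (g x)) _.
have aux (A B : R) : 0 <= A -> 0 <= B -> (A%:E * sqsum (f x) +
    B%:E * sqsum (g x) <= (A * c + B * d)%:E * sqsum x)%E.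
  move=> A0 B0; rewrite EFinD ge0_muleDl ?lee_fin ?mulr_ge0//.
  rewrite (EFinM A) (EFinM B) -!muleA.
  by apply: leeD; apply: lee_wpmul2l; rewrite ?lee_fin.
by apply: aux => //; rewrite mulr_ge0// sqr_ge0.
Qed.

HB.instance Definition _ J I :=
  GRing.isSubmodClosed.Build _ _ (@bounded_linear J I)
    (@bounded_linear_submod J I).

(* Bounded operators from l^2(J) to l^2(I): the first index is the domain. *)
Record bop J I := Bop {
  bop_fun :> ell2 J -> ell2 I ;
  _ : bop_fun \in @bounded_linear J I
}.

HB.instance Definition _ J I := [isSub for @bop_fun J I].
HB.instance Definition _ J I := [Choice of bop J I by <:].
HB.instance Definition _ J I := [SubChoice_isSubLmodule of bop J I by <:].

Lemma id_subproof I : (id : ell2 I -> ell2 I) \in @bounded_linear I I.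
Proof.
by apply/bounded_linearP; split=> //; exists 1 => // x; rewrite mul1e.
Qed.
Definition idop I : bop I I := Bop (id_subproof I).

Lemma comp_subproof K J I (S : bop J I) (T : bop K J) :
  (S \o T : ell2 K -> ell2 I) \in @bounded_linear K I.
Proof.
have /bounded_linearP[lS [c c0 hc]] := valP S.
have /bounded_linearP[lT [d d0 hd]] := valP T.
apply/bounded_linearP; split; first by move=> a x y /=; rewrite lT lS.
exists (c * d) => [|x]; first exact: mulr_ge0.
apply: le_trans (hc _) _; rewrite EFinM -muleA.
by apply: lee_wpmul2l; [rewrite lee_fin|exact: hd].
Qed.
Definition bcomp K J I (S : bop J I) (T : bop K J) : bop K I :=
  Bop (comp_subproof S T).

(* The adjoint exists by the Riesz representation theorem and is unique. *)
Definition adj J I (T : bop J I) : bop I J :=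
  xget 0 [set S : bop I J | forall x y, inner (T x) y = inner x (S y)].

(* The Hilbert tensor product l^2(P) (x) l^2(J) is l^2(P * J), with
   e_p (x) e_j = e_(p, j). *)

Lemma sqsum_prod P J (z : P * J -> C) :
  sqsum z = \esum_(p in [set: P]) sqsum (fun j => z (p, j)).
Proof.
rewrite /sqsum esum_esum; last by move=> *; rewrite lee_fin sqr_ge0.
rewrite (_ : _ `*`` _ = setT); last by apply/seteqP.
by apply: eq_esum => -[].
Qed.

Lemma sqsum_inj_le I J (f : I -> J) (z : J -> C) : injective f ->
  (sqsum (z \o f) <= sqsum z)%E.
Proof.
move=> fI; rewrite /sqsum.
rewrite -(reindex_esum setT (f @` setT) f (fun j => (Normc.normc (z j) ^+ 2)%:E)).
  rewrite esum_mkcond; apply: le_esum => j _.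
  by case: ifP => // _; rewrite lee_fin sqr_ge0.
by split=> [i _|i j _ _ /fI//|//]; exists i.
Qed.

Lemma slice_subproof P J (p : P) (z : ell2 (P * J)%type) :
  (fun j => z (p, j)) \in @square_summable J.
Proof.
apply: le_lt_trans (sqsum_fin z).
by apply: (@sqsum_inj_le _ _ (pair p) z) => i j [].
Qed.
Definition slice P J (p : P) (z : ell2 (P * J)%type) : ell2 J :=
  Ell2 (slice_subproof p z).

Lemma ampl_fun_bound P J I (T : bop J I) (c : R) (z : ell2 (P * J)%type) :
  0 <= c -> (forall x, (sqsum (T x) <= c%:E * sqsum x)%E) ->
  (sqsum (fun pi : P * I => T (slice pi.1 z) pi.2) <= c%:E * sqsum z)%E.
Proof.
move=> c0 hc; rewrite !sqsum_prod.
apply: le_trans (le_esumZ c0 _); last by move=> p; exact: sqsum_ge0.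
by apply: le_esum => p _; exact: (hc (slice p z)).
Qed.

Lemma ampl_fun_subproof P J I (T : bop J I) (z : ell2 (P * J)%type) :
  (fun pi : P * I => T (slice pi.1 z) pi.2) \in @square_summable (P * I)%type.
Proof.
have /bounded_linearP[_ [c c0 hc]] := valP T.
apply: le_lt_trans (ampl_fun_bound _ c0 hc) _.
by rewrite lte_mul_pinfty// ?sqsum_ge0 ?lee_fin ?sqsum_fin.
Qed.
Definition ampl_fun P J I (T : bop J I) (z : ell2 (P * J)%type) :
  ell2 (P * I)%type := Ell2 (ampl_fun_subproof T z).

Lemma ampl_subproof P J I (T : bop J I) :
  @ampl_fun P J I T \in @bounded_linear (P * J)%type (P * I)%type.
Proof.
have /bounded_linearP[lT [c c0 hc]] := valP T.
apply/bounded_linearP; split; last first.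
  by exists c => // z; exact: ampl_fun_bound.
move=> a y z; apply: val_inj; apply/funext => -[p i] /=.
have -> : slice p (a *: y + z) = a *: slice p y + slice p z.
  exact: val_inj.
by rewrite lT.
Qed.
(* 1 (x) T : l^2(P) (x) l^2(J) -> l^2(P) (x) l^2(I). *)
Definition ampl P J I (T : bop J I) : bop (P * J)%type (P * I)%type :=
  Bop (ampl_subproof P T).

Lemma ket_fun_bound P N (n : N) (x : ell2 P) :
  (sqsum (fun pm : P * N => if pm.2 == n then x pm.1 else 0%R) <= sqsum x)%E.
Proof.
rewrite sqsum_prod; apply: le_esum => p _.
rewrite -(@esum_set1 R N n (fun=> (Normc.normc (x p) ^+ 2)%:E)) ?lee_fin ?sqr_ge0//.
rewrite esum_mkcond; apply: le_esum => m _ /=.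
rewrite in_set1; case: (m == n) => //.
by rewrite (_ : Normc.normc _ = 0) ?expr0n//; exact: Normc.normc0.
Qed.

Lemma ket_fun_subproof P N (n : N) (x : ell2 P) :
  (fun pm : P * N => if pm.2 == n then x pm.1 else 0) \in
    @square_summable (P * N)%type.
Proof. exact: le_lt_trans (ket_fun_bound n x) (sqsum_fin x). Qed.
Definition ket_fun P N (n : N) (x : ell2 P) : ell2 (P * N)%type :=
  Ell2 (ket_fun_subproof n x).

Lemma ket_subproof P N (n : N) :
  @ket_fun P N n \in @bounded_linear P (P * N)%type.
Proof.
apply/bounded_linearP; split; last first.
  by exists 1 => // x; rewrite mul1e; exact: ket_fun_bound.
move=> a x y; apply: val_inj; apply/funext => -[p m] /=.
transitivity (a * (if m == n then x p else 0) + (if m == n then y p else 0)).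
  by case: ifP => // _; rewrite mulr0 addr0.
by [].
Qed.

(* x |-> x (x) e_n *)
Definition ket P N (n : N) : bop P (P * N)%type := Bop (ket_subproof P n).

Lemma bra_fun_bound P N (n : N) (z : ell2 (P * N)%type) :
  (sqsum (fun p => z (p, n)) <= sqsum z)%E.
Proof. by apply: (@sqsum_inj_le _ _ (pair^~ n) z) => i j []. Qed.
Lemma bra_fun_subproof P N (n : N) (z : ell2 (P * N)%type) :
  (fun p => z (p, n)) \in @square_summable P.
Proof. exact: le_lt_trans (bra_fun_bound n z) (sqsum_fin z). Qed.
Definition bra_fun P N (n : N) (z : ell2 (P * N)%type) : ell2 P :=
  Ell2 (bra_fun_subproof n z).
Lemma bra_subproof P N (n : N) :
  @bra_fun P N n \in @bounded_linear (P * N)%type P.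
Proof.
apply/bounded_linearP; split; first by move=> a y z; exact: val_inj.
by exists 1 => // z; rewrite mul1e; exact: bra_fun_bound.
Qed.
(* The adjoint of ket n. *)
Definition bra P N (n : N) : bop (P * N)%type P := Bop (bra_subproof P n).

(* The weak* topology of B(l^2(J), l^2(I)), as the dual of the trace class
   operators, is the topology of pointwise convergence on the functionals
     T |-> \sum_(m : nat) <T xi_m, eta_m>,
   with \sum_m |xi_m|^2 < oo and \sum_m |eta_m|^2 < oo.  Such sequences xi and
   eta are the vectors of l^2(nat) (x) l^2(J) and l^2(nat) (x) l^2(I), and the
   functional is T |-> <(1 (x) T) xi, eta>. *)
Definition weakstar_eval J I (T : bop J I)
    : {ptws ell2 (nat * J)%type * ell2 (nat * I)%type -> C} :=
  fun v => inner (ampl nat T v.1) v.2.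
HB.instance Definition _ J I :=
  Topological.copy (bop J I) (initial_topology (@weakstar_eval J I)).

Definition selfadjoint_op I (T : bop I I) : Prop := adj T = T.

Definition positive_op I (T : bop I I) : Prop := forall x, 0 <= inner (T x) x.

Definition le_op I (S T : bop I I) : Prop := positive_op (T - S).

Definition unitary_op I (U : bop I I) : Prop :=
  bcomp (adj U) U = idop I /\ bcomp U (adj U) = idop I.

(* The operator norm of T is at most M. *)
Definition norm_le J I (T : bop J I) (M : R) : Prop :=
  forall x, norm2 (T x) <= M * norm2 x.

Definition le_set I (X Y : set (bop I I)) : Prop :=
  forall T, Y T -> exists2 S, X S & le_op S T.

(* id (x) tr_n on B(l^2(P) (x) C^n), with tr_n normalized by tr_n 1 = 1. *)
Definition id_tr P n (T : bop (P * 'I_n)%type (P * 'I_n)%type) : bop P P :=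
  n%:R^-1 *: \sum_(j < n) bcomp (bra P j) (bcomp T (ket P j)).

End Ell2.
Arguments ell2 R I : clear implicits.
Arguments bop R J I : clear implicits.
Arguments ampl {R} P {J I} T.

Notation "S ** T" := (bcomp S T) (at level 40, left associativity) : ring_scope.

(* The dimensions 1, 2, ..., oo, and H_d = l^2(idx d). *)
Inductive ncdim := Fin (n : nat) of (0 < n)%N | Infty.

Definition idx (d : ncdim) : choiceType :=
  match d with Fin n _ => 'I_n | Infty => nat end.

Section NcMajorization.
Context {R : realType}.

Local Notation M d := (bop R (idx d) (idx d)).
Local Notation Mp p d := (bop R (idx p * idx d)%type (idx p * idx d)%type).
(* {ptws _} equips k-tuples with the product topology. *)
Local Notation Mk k d := {ptws 'I_k -> M d}.

Definition compress d e (alpha : bop R (idx e) (idx d)) (x : M d) : M e :=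
  adj alpha ** x ** alpha.

Definition compress_amp p d e (alpha : bop R (idx e) (idx d)) (T : Mp p d) :
  Mp p e := ampl (idx p) (adj alpha) ** T ** ampl (idx p) alpha.

Definition nc_ball k (r : R) d : set (Mk k d) :=
  [set x | le_op (\sum_(i < k) x i ** adj (x i))
                 ((r ^+ 2)%:C *: idop (idx d))].

(* A multivalued function on the ball is represented by a function on all
   tuples, whose values outside the ball are never used. *)
Definition mvfun k p := forall d, Mk k d -> set (Mp p d).

Section Properties.
Variables (k : nat) (r : R) (p : ncdim) (F : mvfun k p).

Definition multivalued_nc : Prop := forall d (x : Mk k d), nc_ball r x ->
  [/\ F x !=set0,
      F x `<=` [set T | selfadjoint_op T],
      forall alpha : M d, unitary_op alpha ->
        F (fun i => compress alpha (x i)) = compress_amp alpha @` F x &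
      F x = [set T + P | T in F x & P in [set P | positive_op P]]].

Definition mv_bounded : Prop := exists2 lambda : R, 0 < lambda &
  forall d (x : Mk k d) (T : Mp p d), nc_ball r x -> F x T ->
    exists S, [/\ F x S, le_op S T & norm_le S lambda].

Definition mv_graph d : set (Mk k d * Mp p d) :=
  [set xT | nc_ball r xT.1 /\ F xT.1 xT.2].

Definition mv_lsc : Prop := forall d, closed (mv_graph (d := d)).

(* The limits are taken in the weak* topology; both series of compressions
   always converge, as the sequences x and T are bounded. *)
Definition mv_convex : Prop :=
  forall d (e : nat -> ncdim)
    (x : forall i, Mk k (e i)) (T : forall i, Mp p (e i))
    (alpha : forall i, bop R (idx d) (idx (e i))),
  (forall i, mv_graph (x i, T i)) ->
  (exists M : R, forall i, (forall j, norm_le (x i j) M) /\ norm_le (T i) M) ->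
  series (fun i => adj (alpha i) ** alpha i) @ \oo --> idop (idx d) ->
  forall (y : Mk k d) (S : Mp p d),
    (forall j, series (fun i => compress (alpha i) (x i j)) @ \oo --> y j) ->
    series (fun i => compress_amp (alpha i) (T i)) @ \oo --> S ->
  mv_graph (y, S).

Definition nc_majorization_function : Prop :=
  [/\ multivalued_nc, mv_bounded, mv_lsc & mv_convex].

End Properties.

Definition majorized k n (n_gt0 : (0 < n)%N) (a b : 'I_k -> bop R 'I_n 'I_n) :
    Prop :=
  forall r : R, 0 < r ->
    @nc_ball k r (Fin n_gt0) a -> @nc_ball k r (Fin n_gt0) b ->
  forall p (F : mvfun k p), nc_majorization_function r F ->
    le_set (@id_tr R (idx p) n @` F (Fin n_gt0) a)
           (@id_tr R (idx p) n @` F (Fin n_gt0) b).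

(* A map of this form is automatically unital, completely positive and trace
   preserving. *)
Definition mixed_unitary n (Phi : bop R 'I_n 'I_n -> bop R 'I_n 'I_n) : Prop :=
  exists (l : nat) (u : 'I_l -> bop R 'I_n 'I_n) (t : 'I_l -> R),
    [/\ forall i, unitary_op (u i),
        forall i, 0 <= t i <= 1,
        \sum_(i < l) t i = 1 &
        forall x, Phi x = \sum_(i < l) (t i)%:C *: (u i ** x ** adj (u i))].

End NcMajorization.

(* Main.v *)
From HB Require Import structures.
Require Import Defs.
From mathcomp Require Import all_boot all_order all_algebra.
From mathcomp Require Import reals.
From mathcomp Require Import finmap complex ring.
From mathcomp Require Import all_classical all_analysis.
From mathcomp.analysis.showcase Require Import summability.
Set Implicit Arguments.
Unset Strict Implicit.
Unset Printing Implicit Defensive.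
Import Order.TTheory GRing.Theory Num.Theory.
Import numFieldNormedType.Exports.
Local Open Scope ring_scope.
Local Open Scope sesquilinear_scope.

(** Every image of a tuple under a unital trace-preserving completely positive
map is majorized by the tuple, and some of these maps are not mixed unitary.

If [Phi(x) = \sum_s A_s^* x A_s] with [\sum_s A_s^* A_s = 1] and
[\sum_s A_s A_s^* = 1], then [Phi(b)] is majorized by [b]
([majorized_channel]): for [T] in [F(b)], convexity of [F] puts
[S = \sum_s (1 (x) A_s^* ) T (1 (x) A_s)] in [F(Phi(b))], and the second
identity gives [(id (x) tr) S = (id (x) tr) T] ([id_tr_channel]).

Take for [Phi] the Schur multiplication by the Gram matrix of the unit vectors
[e_1], [e_2], [(3 e_1 + 4 e_2) / 5], [(3 e_1 + 4 i e_2) / 5], [e_1], [e_1], and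
so on in [C^2]; its two Kraus operators are diagonal.  Let [b] consist of a
diagonal matrix with distinct real entries and of copies of the all-ones matrix
[J].  The first is fixed by [Phi], and [Phi J] is the Gram matrix itself.

Suppose that a mixture of unitary conjugations with weights [t_i] agrees with
[Phi] on [b].  It fixes the diagonal matrix, so by strict convexity of the
Hilbert-Schmidt norm every unitary of nonzero weight commutes with that matrix
([mixed_unitary_fix_commute]), hence is diagonal.  The image of [J] is then
[\sum_i t_i x_i x_i^*] with unimodular vectors [x_i].  As this equals the Gram
matrix, every [x_i] of nonzero weight inherits the linear relations between the
vectors of [C^2] ([gram_relation]): its first four coordinates satisfy
[3 x_0 + 4 x_1 = 5 x_2] and [3 x_0 + 4 i x_1 = 5 x_3].  Taking moduli, the real
and imaginary parts of [x_0] times the conjugate of [x_1] vanish, which is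
impossible for unimodular numbers ([unimodular_345]). *)

(** * Mixtures of unitary conjugations and Gram matrices *)

Section Matrices.
Variable C : numClosedFieldType.

Lemma sum_ge0_eq0 (I : finType) (w f : I -> C) :
  (forall i, 0 <= w i) -> (forall i, 0 <= f i) ->
  \sum_i w i * f i = 0 -> forall i, w i != 0 -> f i = 0.
Proof.
move=> w0 f0 /psumr_eq0P h i wi.
have /eqP := h (fun i _ => mulr_ge0 (w0 i) (f0 i)) i isT.
by rewrite mulf_eq0 (negPf wi) => /eqP.
Qed.

Lemma mxtrace_mulct_ge0 n (M : 'M[C]_n) : 0 <= \tr (M *m M^t*).
Proof.
apply: sumr_ge0 => i _; rewrite mxE; apply: sumr_ge0 => j _.
by rewrite !mxE mul_conjC_ge0.
Qed.

Lemma mxtrace_mulct_eq0 n (M : 'M[C]_n) : \tr (M *m M^t*) = 0 -> M = 0.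
Proof.
have h0 i j : 0 <= M i j * (M^t*) j i by rewrite !mxE mul_conjC_ge0.
move=> /psumr_eq0P h; apply/matrixP => i j; rewrite mxE.
have /psumr_eq0P h' : \sum_j M i j * (M^t*) j i = 0.
  have := h _ i isT; rewrite mxE; apply => k _.
  by rewrite mxE; apply: sumr_ge0.
have /eqP := h' (fun j _ => h0 i j) j isT.
by rewrite !mxE mul_conjC_eq0 => /eqP.
Qed.

(** All the conjugates [U_i H U_i^*] have the Hilbert-Schmidt norm of [H].  If
their average is [H], those of nonzero weight are therefore equal to [H]. *)
Lemma mixed_unitary_fix_commute n (H : 'M[C]_n) l (U : 'I_l -> 'M[C]_n)
    (t : 'I_l -> C) :
  H^t* = H -> (forall i, (U i)^t* *m U i = 1%:M) ->
  (forall i, 0 <= t i) -> \sum_i t i = 1 ->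
  \sum_i t i *: (U i *m H *m (U i)^t*) = H ->
  forall i, t i != 0 -> U i *m H = H *m U i.
Proof.
move=> HH UU t0 t1 fixH i ti.
(* The squared norm of [M i] is a linear function of [M i], and the [M i]
   average to 0. *)
pose M i := U i *m H *m (U i)^t* - H.
have MH j : (M j)^t* = M j.
  by rewrite /M linearB/= map_mxB HH !trmx_mul !map_mxM !mulmxA HH trmxCK.
have trM j : \tr (M j *m (M j)^t*) = - 2 * \tr (M j *m H).
  rewrite MH {1 2}/M.
  pose K := U j *m H *m (U j)^t*.
  have -> : \tr ((K - H) *m (K - H)) =
      \tr (K *m K) + \tr (H *m H) - 2 * \tr (K *m H).
    rewrite mulmxBl !mulmxBr !raddfB/= (mxtrace_mulC H K).
    by move: (\tr _) (\tr _) (\tr _) => x y z; ring.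
  have -> : \tr (K *m K) = \tr (H *m H).
    rewrite /K !mulmxA mxtrace_mulC !mulmxA UU mul1mx.
    by rewrite -!mulmxA (mulmxA _ (U j)) UU mul1mx.
  rewrite -/K mulmxBl raddfB/= -/K.
  by move: (\tr _) (\tr _) => x y; ring.
have sumM : \sum_j t j *: M j = 0.
  rewrite /M; under eq_bigr do rewrite scalerBr.
  by rewrite sumrB fixH -scaler_suml t1 scale1r subrr.
have h : \sum_j t j * \tr (M j *m (M j)^t*) = 0.
  under eq_bigr => j _ do rewrite trM mulrCA -mxtraceZ scalemxAl.
  by rewrite -mulr_sumr -raddf_sum -mulmx_suml sumM mul0mx raddf0 mulr0.
have /mxtrace_mulct_eq0/eqP :=
  sum_ge0_eq0 t0 (fun j => mxtrace_mulct_ge0 (M j)) h ti.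
rewrite subr_eq0 => /eqP e; rewrite -{2}e.
by rewrite -!mulmxA UU mulmx1.
Qed.

Lemma commute_diag_mx n (d : 'rV[C]_n) (U : 'M[C]_n) :
  injective (d 0) -> U *m diag_mx d = diag_mx d *m U ->
  forall i j, i != j -> U i j = 0.
Proof.
move=> dI /matrixP h i j ij; have := h i j.
rewrite mul_mx_diag mul_diag_mx !mxE => e.
have /eqP : (d 0 j - d 0 i) * U i j = 0 by rewrite mulrBl -e mulrC subrr.
by rewrite mulf_eq0 subr_eq0 (inj_eq dI) eq_sym (negPf ij) => /eqP.
Qed.

Lemma sum_normCK_lin (S I : finType) (w : S -> C) (v : S -> I -> C)
    (c : I -> C) :
  \sum_s w s * `|\sum_i c i * v s i| ^+ 2 =
  \sum_i \sum_j c i * (c j)^* * \sum_s w s * (v s i * (v s j)^*).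
Proof.
under eq_bigr => s _.
  rewrite normCK rmorph_sum/= big_distrlr/= mulr_sumr.
  under eq_bigr do rewrite mulr_sumr.
  over.
rewrite exchange_big; apply: eq_bigr => i _; rewrite exchange_big.
apply: eq_bigr => j _; rewrite mulr_sumr; apply: eq_bigr => s _.
by rewrite rmorphM/=; ring.
Qed.

(** If the vectors [v s], with weights [w s], and the vectors [d s] have the
same matrix of second moments, then a linear form vanishing on all the [d s]
vanishes on every [v s] of nonzero weight. *)
Lemma gram_relation (S S' I : finType) (w : S -> C) (v : S -> I -> C)
    (d : S' -> I -> C) (c : I -> C) :
  (forall s, 0 <= w s) ->
  (forall i j, \sum_s w s * (v s i * (v s j)^*) = \sum_s d s i * (d s j)^*) ->
  (forall s, \sum_i c i * d s i = 0) ->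
  forall s, w s != 0 -> \sum_i c i * v s i = 0.
Proof.
move=> w0 vd cd s ws.
have h : \sum_s w s * `|\sum_i c i * v s i| ^+ 2 = 0.
  rewrite sum_normCK_lin.
  have := sum_normCK_lin (fun=> 1) d c.
  under eq_bigr do rewrite cd normr0 expr0n/= mulr0.
  rewrite sumr_const mul0rn => h0; apply: etrans (esym h0).
  apply: eq_bigr => i _; apply: eq_bigr => j _; rewrite vd.
  by under [in RHS]eq_bigr do rewrite mul1r.
have /eqP := sum_ge0_eq0 w0 (fun s => exprn_ge0 2 (normr_ge0 _)) h ws.
by rewrite sqrf_eq0 normr_eq0 => /eqP.
Qed.

(** The square of the modulus of [3 x0 + 4 x1] is [25 + 24 Re p], and that of
[3 x0 + 4 i x1] is [25 + 24 Im p], with [p] the product of [x0] and the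
conjugate of [x1].  As both are 25, the unimodular number [p] would be 0. *)
Lemma unimodular_345 (x0 x1 x2 x3 : C) :
  [/\ x0 * x0^* = 1, x1 * x1^* = 1, x2 * x2^* = 1 & x3 * x3^* = 1] ->
  3 * x0 + 4 * x1 = 5 * x2 -> 3 * x0 + 4 * 'i * x1 = 5 * x3 -> False.
Proof.
move=> [n0 n1 n2 n3] e2 e3; pose p := x0 * x1^*; pose q := x0^* * x1.
have c3 : (3 : C)^* = 3 by rewrite conjC_nat.
have c4 : (4 : C)^* = 4 by rewrite conjC_nat.
have c5 : (5 : C)^* = 5 by rewrite conjC_nat.
have ii : 'i * 'i = -1 :> C by rewrite -expr2 sqrCi.
have f2 := congr1 Num.conj e2; have f3 := congr1 Num.conj e3.
rewrite !rmorphD !rmorphM/= ?c3 ?c4 ?c5 ?conjCi in f2 f3.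
have g2 : (3 * x0 + 4 * x1) * (3 * x0^* + 4 * x1^*) = 25 * (x2 * x2^*).
  by rewrite e2 f2; ring.
have g3 : (3 * x0 + 4 * 'i * x1) * (3 * x0^* + 4 * (- 'i) * x1^*) =
    25 * (x3 * x3^*).
  by rewrite e3 f3; ring.
have h2 : 12 * (p + q) = 0.
  have : (3 * x0 + 4 * x1) * (3 * x0^* + 4 * x1^*) =
     9 * (x0 * x0^*) + 16 * (x1 * x1^*) + 12 * (p + q).
    by rewrite /p /q; ring.
  rewrite g2 n0 n1 n2 => h; apply: (addrI (9 * 1 + 16 * 1)).
  by rewrite -h; ring.
have h3 : 12 * 'i * (q - p) = 0.
  have : (3 * x0 + 4 * 'i * x1) * (3 * x0^* + 4 * (- 'i) * x1^*) =
     9 * (x0 * x0^*) - 16 * ('i * 'i) * (x1 * x1^*) +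
     12 * 'i * (q - p).
    by rewrite /p /q; ring.
  rewrite g3 ii n0 n1 n3 => h; apply: (addrI (9 * 1 - 16 * (-1) * 1)).
  by rewrite -h; ring.
have qp : q = p.
  move/eqP: h3; rewrite !mulf_eq0 pnatr_eq0 (negPf (neq0Ci _))/= subr_eq0.
  by move/eqP.
move/eqP: h2; rewrite qp -mulr2n mulf_eq0 pnatr_eq0/= mulrn_eq0/= => /eqP p0.
have : p * q = 1.
  transitivity ((x0 * x0^*) * (x1 * x1^*)).
    by rewrite /p /q; ring.
  by rewrite n0 n1 mulr1.
by rewrite p0 mul0r => /eqP; rewrite eq_sym oner_eq0.
Qed.
End Matrices.

(** * Operators on a finite-dimensional space as matrices *)

#[local] Existing Instance totally_filter.

Section Operators.
Context {R : realType}.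
Local Notation C := (CC R).

Lemma lim_sum_fin (I : finType) (f : I -> C) :
  lim (partial_sum f @ totally)%classic = \sum_i f i.
Proof.
apply: cvg_lim; first exact: norm_hausdorff.
apply: cvg_near_cst; exists [fset i | i in I]%fset => // B /= sB.
have inB i : i \in B by apply: (fsubsetP sB); rewrite in_fset.
rewrite /partial_sum (reindex_onto (fun i => [` inB i]%fset) val) => [|b _].
  by apply: eq_big => // i; rewrite eqxx.
exact: val_inj.
Qed.

Lemma inner_fin (I : finType) (x y : ell2 R I) :
  inner x y = \sum_i x i * (y i)^*.
Proof. exact: lim_sum_fin. Qed.

Lemma ell2P (I : choiceType) (x y : ell2 R I) : (forall i, x i = y i) -> x = y.
Proof. by move=> h; apply: val_inj; apply/funext. Qed.

Lemma bopP (I J : choiceType) (S T : bop R J I) :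
  (forall x, S x = T x) -> S = T.
Proof. by move=> h; apply: val_inj; apply/funext. Qed.

Lemma bop_linear (I J : choiceType) (T : bop R J I) : linear T.
Proof. by have /bounded_linearP[] := valP T. Qed.

HB.instance Definition _ (I J : choiceType) (T : bop R J I) :=
  GRing.isLinear.Build C (ell2 R J) (ell2 R I) _ T (bop_linear T).

Lemma ell2Z (I : choiceType) a (x : ell2 R I) i : (a *: x) i = a * x i.
Proof. by []. Qed.
Lemma ell20 (I : choiceType) i : (0 : ell2 R I) i = 0.
Proof. by []. Qed.
Lemma ell2_sum (I : choiceType) (K : Type) (r : seq K) (P : pred K)
    (f : K -> ell2 R I) i :
  (\sum_(k <- r | P k) f k) i = \sum_(k <- r | P k) f k i.
Proof. by apply: (big_morph (fun x : ell2 R I => x i)). Qed.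
Lemma bopZE (I J : choiceType) a (S : bop R J I) x : (a *: S) x = a *: S x.
Proof. by []. Qed.
Lemma bop_sum (I J : choiceType) (K : Type) (r : seq K) (P : pred K)
    (f : K -> bop R J I) x :
  (\sum_(k <- r | P k) f k) x = \sum_(k <- r | P k) f k x.
Proof. by apply: (big_morph (fun T : bop R J I => T x)). Qed.

Lemma square_summable_fin (I : finType) (x : I -> C) :
  x \in @square_summable R I.
Proof.
have finI : finite_set [set: I] by exact: finite_finset.
rewrite unfold_in /sqsum (esum_fset finI) => [|i _];
  last by rewrite lee_fin sqr_ge0.
by rewrite (fsbig_finite _ _ finI) sumEFin ltry.
Qed.
(** The vector with coordinates [x]. *)
Definition vec (I : finType) (x : I -> C) : ell2 R I :=
  Ell2 (square_summable_fin x).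

(** The standard basis. *)
Definition basis (I : finType) (j : I) : ell2 R I := vec (fun i => (i == j)%:R).

Lemma ell2_basis (I : finType) (x : ell2 R I) : x = \sum_j x j *: basis j.
Proof.
apply: ell2P => i; rewrite ell2_sum (big_only1 i) => [||j /negPf ji _] //.
  by rewrite ell2Z /= eqxx mulr1.
by rewrite ell2Z /= eq_sym ji mulr0.
Qed.

Lemma mxunit_fun_bound (I J : choiceType) (i : I) (j : J) (x : ell2 R J) :
  (sqsum (fun i' : I => if i' == i then x j else 0%R) <= sqsum x)%E.
Proof.
apply: (@le_trans _ _ (Normc.normc (x j) ^+ 2)%:E).
  rewrite -(@esum_set1 R I i (fun=> (Normc.normc (x j) ^+ 2)%:E));
    last by rewrite lee_fin sqr_ge0.
  rewrite esum_mkcond; apply: le_esum => m _ /=.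
  rewrite in_set1; case: (m == i) => //.
  by rewrite (_ : Normc.normc _ = 0) ?expr0n//; exact: Normc.normc0.
rewrite -(@esum_set1 R J j (fun j => (Normc.normc (x j) ^+ 2)%:E));
  last by rewrite lee_fin sqr_ge0.
rewrite esum_mkcond; apply: le_esum => m _ /=.
by case: ifP => // _; rewrite lee_fin sqr_ge0.
Qed.

Lemma mxunit_fun_subproof (I J : choiceType) (i : I) (j : J) (x : ell2 R J) :
  (fun i' : I => if i' == i then x j else 0%R) \in @square_summable R I.
Proof. exact: le_lt_trans (mxunit_fun_bound i j x) (sqsum_fin x). Qed.
Definition mxunit_fun (I J : choiceType) (i : I) (j : J) (x : ell2 R J) :
  ell2 R I := Ell2 (mxunit_fun_subproof i j x).

Lemma mxunit_subproof (I J : choiceType) (i : I) (j : J) :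
  mxunit_fun i j \in @bounded_linear R J I.
Proof.
apply/bounded_linearP; split; last first.
  by exists 1 => // x; rewrite mul1e; exact: mxunit_fun_bound.
move=> a x y; apply: ell2P => m.
rewrite -[LHS]/(if m == i then a * x j + y j else 0).
rewrite -[RHS]/(a * (if m == i then x j else 0) + (if m == i then y j else 0)).
by case: ifP; rewrite ?mulr0 ?addr0.
Qed.
(** The operator mapping [e_j] to [e_i] and the other basis vectors to 0. *)
Definition mxunit (I J : choiceType) (i : I) (j : J) : bop R J I :=
  Bop (mxunit_subproof i j).

(** The operator with matrix [A] in the standard bases. *)
Definition op_of_mx m n (A : 'M[C]_(m, n)) : bop R 'I_n 'I_m :=
  \sum_i \sum_j A i j *: mxunit i j.

Lemma op_of_mxE m n (A : 'M[C]_(m, n)) x i :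
  op_of_mx A x i = \sum_j A i j * x j.
Proof.
rewrite /op_of_mx bop_sum ell2_sum (big_only1 i) => [||k /negPf ki _] //.
  rewrite bop_sum ell2_sum; apply: eq_bigr => j _.
  by rewrite bopZE ell2Z /= eqxx.
rewrite bop_sum ell2_sum big1// => j _.
by rewrite bopZE ell2Z /= eq_sym ki mulr0.
Qed.

(** The matrix of [T] in the standard bases. *)
Definition mx_of_op m n (T : bop R 'I_n 'I_m) : 'M[C]_(m, n) :=
  \matrix_(i, j) T (basis j) i.

Lemma mx_of_opK m n : cancel (@mx_of_op m n) (@op_of_mx m n).
Proof.
move=> T; apply: bopP => x; apply: ell2P => i.
rewrite op_of_mxE {2}(ell2_basis x) linear_sum ell2_sum.
by apply: eq_bigr => j _; rewrite linearZ ell2Z mxE mulrC.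
Qed.

Lemma op_of_mxK m n : cancel (@op_of_mx m n) (@mx_of_op m n).
Proof.
move=> A; apply/matrixP => i j; rewrite mxE op_of_mxE.
rewrite (big_only1 j) => [||k /negPf kj _] //=.
  by rewrite eqxx mulr1.
by rewrite kj mulr0.
Qed.

Lemma op_of_mx_linear m n : linear (@op_of_mx m n).
Proof.
move=> a A B; apply: bopP => x; apply: ell2P => i.
rewrite -[RHS]/(a * op_of_mx A x i + op_of_mx B x i) !op_of_mxE.
rewrite mulr_sumr -big_split/=.
by apply: eq_bigr => j _; rewrite !mxE mulrDl mulrA.
Qed.
HB.instance Definition _ m n :=
  GRing.isLinear.Build C 'M[C]_(m, n) (bop R 'I_n 'I_m) _
    (@op_of_mx m n) (@op_of_mx_linear m n).

Lemma op_of_mxM m n p (A : 'M[C]_(m, n)) (B : 'M[C]_(n, p)) :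
  op_of_mx A ** op_of_mx B = op_of_mx (A *m B).
Proof.
apply: bopP => x; apply: ell2P => i; rewrite /= !op_of_mxE.
under eq_bigr do rewrite op_of_mxE mulr_sumr.
rewrite exchange_big; apply: eq_bigr => k _; rewrite mxE mulr_suml.
by apply: eq_bigr => j _; rewrite mulrA.
Qed.

Lemma op_of_mx1 n : op_of_mx (1%:M : 'M[C]_n) = idop 'I_n.
Proof.
apply: bopP => x; apply: ell2P => i.
rewrite op_of_mxE (big_only1 i) => [||j /negPf ij _] //.
  by rewrite mxE eqxx mul1r.
by rewrite mxE eq_sym ij mul0r.
Qed.

Lemma adj_op_of_mx m n (A : 'M[C]_(m, n)) : adj (op_of_mx A) = op_of_mx (A^t*).
Proof.
have adjA x y : inner (op_of_mx A x) y = inner x (op_of_mx (A^t*) y).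
  rewrite !inner_fin; under eq_bigr do rewrite op_of_mxE mulr_suml.
  rewrite exchange_big; apply: eq_bigr => j _.
  rewrite op_of_mxE rmorph_sum mulr_sumr.
  by apply: eq_bigr => i _; rewrite rmorphM/= !mxE conjCK; ring.
apply: xget_unique => // S adjS; apply: bopP => y; apply: ell2P => j.
have : inner (basis j) (S y) = inner (basis j) (op_of_mx (A^t*) y).
  by rewrite -adjS adjA.
have inner_basis (z : ell2 R 'I_n) : inner (basis j) z = (z j)^*.
  rewrite inner_fin (big_only1 j) => [||k /negPf kj _] //=.
    by rewrite eqxx mul1r.
  by rewrite kj mul0r.
by rewrite !inner_basis => /(can_inj conjCK).
Qed.

Lemma unitary_op_of_mx n (U : 'M[C]_n) : unitary_op (op_of_mx U) ->
  U^t* *m U = 1%:M /\ U *m U^t* = 1%:M.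
Proof.
rewrite /unitary_op adj_op_of_mx !op_of_mxM -op_of_mx1.
by case=> /(can_inj (@op_of_mxK n n)) ? /(can_inj (@op_of_mxK n n)).
Qed.

Lemma selfadjoint_op_of_mx n (A : 'M[C]_n) :
  A^t* = A -> selfadjoint_op (op_of_mx A).
Proof. by rewrite /selfadjoint_op adj_op_of_mx => ->. Qed.
End Operators.

(** * Majorization under unital trace-preserving completely positive maps *)

Section Channels.
Context {R : realType}.
Local Notation C := (CC R).

Lemma inner0l (I : choiceType) (x : ell2 R I) : inner 0 x = 0.
Proof.
apply: cvg_lim; first exact: norm_hausdorff.
apply: cvg_near_cst; apply: nearW => B.
by rewrite /partial_sum big1// => i _; rewrite ell20 mul0r.
Qed.

Lemma le_op_refl (I : choiceType) (T : bop R I I) : le_op T T.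
Proof. by move=> x; rewrite subrr inner0l. Qed.

Lemma bcompA (H I J K : choiceType) (S : bop R I H) (T : bop R J I)
  (U : bop R K J) : S ** (T ** U) = S ** T ** U.
Proof. exact: bopP. Qed.

Lemma bcomp0r (I J K : choiceType) (S : bop R J I) : S ** (0 : bop R K J) = 0.
Proof. by apply: bopP => x; exact: linear0. Qed.

Lemma ampl0 (P I J : choiceType) : ampl P (0 : bop R J I) = 0.
Proof. by apply: bopP => x; exact: ell2P. Qed.

Lemma bcomp_suml (I J K : choiceType) m (S : 'I_m -> bop R J I)
    (T : bop R K J) :
  (\sum_s S s) ** T = \sum_s S s ** T.
Proof. by apply: bopP => x; rewrite /= !bop_sum. Qed.

Lemma bcomp_sumr (I J K : choiceType) m (S : bop R J I)
    (T : 'I_m -> bop R K J) :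
  S ** (\sum_s T s) = \sum_s S ** T s.
Proof. by apply: bopP => x; rewrite /= !bop_sum linear_sum. Qed.

Lemma bcompZl (I J K : choiceType) a (S : bop R J I) (T : bop R K J) :
  (a *: S) ** T = a *: (S ** T).
Proof. exact: bopP. Qed.

Lemma bcompZr (I J K : choiceType) a (S : bop R J I) (T : bop R K J) :
  S ** (a *: T) = a *: (S ** T).
Proof. by apply: bopP => x; exact: linearZ. Qed.

Lemma ampl_ket (P : choiceType) m n (A : 'M[C]_(m, n)) j :
  ampl P (op_of_mx A) ** ket P j = \sum_i A i j *: ket P i.
Proof.
apply: bopP => x; rewrite bop_sum; apply: ell2P => -[q i].
rewrite ell2_sum (big_only1 i) => [||k /negPf ki _] //; last first.
  by rewrite bopZE ell2Z /= eq_sym ki mulr0.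
rewrite bopZE ell2Z /= eqxx op_of_mxE (big_only1 j) => [||k /negPf kj _] //=.
  by rewrite eqxx.
by rewrite kj mulr0.
Qed.

Lemma bra_ampl (P : choiceType) m n (A : 'M[C]_(m, n)) i :
  bra P i ** ampl P (op_of_mx A) = \sum_j A i j *: bra P j.
Proof.
apply: bopP => x; rewrite bop_sum; apply: ell2P => q.
by rewrite ell2_sum /= op_of_mxE; apply: eq_bigr => j _.
Qed.

(** Both sides are combinations of the compressions [X i k] of [T], and the
coefficient on the left is the [(k, i)] entry of [\sum_s A_s A_s^* = 1]. *)
Lemma id_tr_channel (P : choiceType) n m (A : 'I_m -> 'M[C]_n)
    (T : bop R (P * 'I_n)%type (P * 'I_n)%type) :
  \sum_s A s *m (A s)^t* = 1%:M ->
  id_tr (\sum_s ampl P (op_of_mx ((A s)^t*)) ** T ** ampl P (op_of_mx (A s))) =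
  id_tr T.
Proof.
move=> AA; congr (_ *: _).
pose X i k := bra P i ** T ** ket P k.
transitivity (\sum_i \sum_k (\sum_s A s *m (A s)^t*) k i *: X i k); last first.
  apply: eq_bigr => i _; rewrite AA (big_only1 i) => [||k /negPf ki _] //.
    by rewrite mxE eqxx scale1r /X bcompA.
  by rewrite mxE ki scale0r.
transitivity
  (\sum_j \sum_s \sum_i \sum_k (A s k j * ((A s)^t*) j i) *: X i k).
  apply: eq_bigr => j _; rewrite bcomp_suml bcomp_sumr; apply: eq_bigr => s _.
  rewrite -!bcompA ampl_ket !bcompA bra_ampl !bcomp_suml; apply: eq_bigr => i _.
  rewrite bcomp_sumr; apply: eq_bigr => k _.
  by rewrite !bcompZl bcompZr scalerA mulrC.
rewrite exchange_big/=.
under eq_bigr do rewrite exchange_big/=.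
rewrite exchange_big/=; apply: eq_bigr => i _.
under eq_bigr do rewrite exchange_big/=.
rewrite exchange_big/=; apply: eq_bigr => k _.
rewrite summxE scaler_suml; apply: eq_bigr => s _.
by rewrite mxE scaler_suml.
Qed.

Lemma series_finite (I J : choiceType) m (f : nat -> bop R J I) :
  (forall s, (m <= s)%N -> f s = 0) ->
  (series f @ \oo --> \sum_(s < m) f s)%classic.
Proof.
move=> f0; apply: cvg_near_cst; exists m => // N /= mN.
rewrite /series /= (big_cat_nat (leq0n m) mN)//= big_mkord [X in _ + X]big_nat.
by rewrite [X in _ + X]big1 ?addr0// => s /andP[/f0].
Qed.

Lemma norm_le_ex (I J : choiceType) (T : bop R J I) : exists M, norm_le T M.
Proof. by have /asboolP[_ []] := valP T => M; exists M. Qed.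

Lemma norm_le_mono (I J : choiceType) (T : bop R J I) M N :
  M <= N -> norm_le T M -> norm_le T N.
Proof.
by move=> MN TM x; apply: le_trans (TM x) _; rewrite ler_wpM2r ?sqrtr_ge0.
Qed.

(** A unital trace-preserving completely positive map sends every tuple to one
that it majorizes. *)
Lemma majorized_channel k n (n_gt0 : (0 < n)%N) m (A : nat -> 'M[C]_n)
    (b : 'I_k -> bop R 'I_n 'I_n) :
  \sum_(s < m) (A s)^t* *m A s = 1%:M ->
  \sum_(s < m) A s *m (A s)^t* = 1%:M ->
  majorized n_gt0
    (fun i => \sum_(s < m) op_of_mx ((A s)^t*) ** b i ** op_of_mx (A s)) b.
Proof.
move=> AA1 AA2 r r0 _ hb p F [_ _ _ conv] _ [T FT <-].
pose S := \sum_(s < m)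
  ampl (idx p) (op_of_mx ((A s)^t*)) ** T ** ampl (idx p) (op_of_mx (A s)).
exists (id_tr S); last by rewrite /S id_tr_channel//; exact: le_op_refl.
exists S => //.
(* Convexity takes a sequence of coefficients: the Kraus operators followed by
   zeros, so that all the series involved are eventually constant. *)
pose alpha s := if (s < m)%N then op_of_mx (A s) else 0.
have alpha0 s : (m <= s)%N -> alpha s = 0 by rewrite /alpha ltnNge => ->.
have alphaE (s : 'I_m) : alpha s = op_of_mx (A s) by rewrite /alpha ltn_ord.
have [M hM] := boolp.choice (fun j => norm_le_ex (b j)).
have [N hN] := norm_le_ex T.
suff [] : @mv_graph R k r p F (Fin n_gt0)
    (fun i => \sum_(s < m)
       op_of_mx ((A s)^t*) ** b i ** op_of_mx (A s), S) by [].
apply: (conv (Fin n_gt0) (fun=> Fin n_gt0) (fun=> b) (fun=> T) alpha).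
- by [].
- exists (\sum_j `|M j| + `|N|) => _; split=> [j|].
    apply: norm_le_mono (hM j); apply: le_trans (ler_norm _) _.
    by rewrite (bigD1 j)//= -addrA lerDl addr_ge0// sumr_ge0.
  apply: norm_le_mono hN; apply: le_trans (ler_norm _) _.
  by rewrite lerDr sumr_ge0.
- rewrite -(op_of_mx1 n) -AA1 linear_sum /=.
  have := @series_finite _ _ m (fun s => adj (alpha s) ** alpha s).
  have -> : \sum_(s < m) adj (alpha s) ** alpha s =
      \sum_(s < m) op_of_mx ((A s)^t* *m A s).
    by apply: eq_bigr => s _; rewrite alphaE adj_op_of_mx op_of_mxM.
  by apply=> s /alpha0 ->; rewrite bcomp0r.
- move=> j.
  pose f s := compress (d := Fin n_gt0) (e := Fin n_gt0) (alpha s) (b j).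
  have := @series_finite _ _ m f.
  have -> : \sum_(s < m) f s =
      \sum_(s < m) op_of_mx ((A s)^t*) ** b j ** op_of_mx (A s).
    by apply: eq_bigr => s _; rewrite /f /compress alphaE adj_op_of_mx.
  by apply=> s /alpha0 sm; rewrite /f /compress sm bcomp0r.
- pose f s :=
    compress_amp (p := p) (d := Fin n_gt0) (e := Fin n_gt0) (alpha s) T.
  have := @series_finite _ _ m f.
  have -> : \sum_(s < m) f s = S.
    by apply: eq_bigr => s _; rewrite /f /compress_amp alphaE adj_op_of_mx.
  by apply=> s /alpha0 sm; rewrite /f /compress_amp sm ampl0 bcomp0r.
Qed.
End Channels.

(** * A Schur multiplication that is not mixed unitary on two matrices *)

Section Example.
Context {R : realType}.
Local Notation C := (CC R).

(** [(frame 0 j, frame 1 j)] is the [j]-th of the unit vectors [e_1], [e_2],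
[(3 e_1 + 4 e_2) / 5], [(3 e_1 + 4 i e_2) / 5], [e_1], [e_1], and so on.  The
default values of [nth] provide the vectors of index at least 4. *)
Definition frame (s j : nat) : C :=
  if s == 0%N then nth 1 [:: 1; 0; 3 / 5; 3 / 5] j
  else nth 0 [:: 0; 1; 4 / 5; 4 / 5 * 'i] j.

Lemma frame_unit j : \sum_(s < 2) frame s j * (frame s j)^* = 1.
Proof.
have ii : 'i * (- 'i) = 1 :> C by rewrite mulrN -expr2 sqrCi opprK.
rewrite !big_ord_recl big_ord0 addr0 /frame /=.
case: j => [|[|[|[|j]]]] /=; rewrite ?nth_nil ?nth_default//= ?rmorphM/=
  ?fmorphV/= ?conjCi ?conjC_nat ?conjC1 ?conjC0.
- by ring.
- by ring.
- by field.
- by rewrite [_ * 'i * _]mulrACA ii; field.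
- by ring.
Qed.

(** The conjugates make the adjoint of [kraus n s] the diagonal matrix of
[frame s]. *)
Definition kraus n (s : nat) : 'M[C]_n := diag_mx (\row_j (frame s j)^*).

Lemma kraus_adj n s : (kraus n s)^t* = diag_mx (\row_j frame s j).
Proof.
rewrite /kraus tr_diag_mx map_diag_mx; congr diag_mx.
by apply/rowP => j; rewrite !mxE; exact: conjCK.
Qed.

(** Schur multiplication by the Gram matrix of the frame, given by its Kraus
decomposition. *)
Definition gram_schur n (B : 'M[C]_n) : 'M[C]_n :=
  \sum_(s < 2) (kraus n s)^t* *m B *m kraus n s.

Lemma gram_schurE n (B : 'M[C]_n) i j :
  gram_schur B i j = (\sum_(s < 2) frame s i * (frame s j)^*) * B i j.
Proof.
rewrite summxE mulr_suml; apply: eq_bigr => s _.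
by rewrite kraus_adj mul_mx_diag mul_diag_mx !mxE; ring.
Qed.

Lemma kraus_unital n : \sum_(s < 2) (kraus n s)^t* *m kraus n s = 1%:M.
Proof.
transitivity (gram_schur (1%:M : 'M[C]_n)).
  by apply: eq_bigr => s _; rewrite mulmx1.
apply/matrixP => i j; rewrite gram_schurE mxE; case: eqP => [->|_].
  by rewrite frame_unit mulr1.
by rewrite mulr0.
Qed.

Lemma kraus_tracial n : \sum_(s < 2) kraus n s *m (kraus n s)^t* = 1%:M.
Proof.
rewrite -[RHS]kraus_unital; apply: eq_bigr => s _; rewrite kraus_adj.
by rewrite /kraus diag_mxC.
Qed.

Lemma gram_schur_herm n (B : 'M[C]_n) :
  B^t* = B -> (gram_schur B)^t* = gram_schur B.
Proof.
move=> BB; apply/matrixP => i j; rewrite !mxE !gram_schurE rmorphM rmorph_sum/=.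
rewrite -[in RHS]BB !mxE; congr (_ * _); apply: eq_bigr => s _.
by rewrite rmorphM/= conjCK mulrC.
Qed.

Lemma gram_schur_diag n (d : 'rV[C]_n) : gram_schur (diag_mx d) = diag_mx d.
Proof.
apply/matrixP => i j; rewrite gram_schurE mxE; case: eqP => [->|_].
  by rewrite frame_unit mul1r.
by rewrite mulr0n mulr0.
Qed.

Lemma conj_ones_mxE n (U : 'M[C]_n) j k :
  (U *m const_mx 1 *m U^t*) j k = (\sum_l U j l) * (\sum_l U k l)^*.
Proof.
rewrite mxE rmorph_sum mulr_sumr; apply: eq_bigr => m _; rewrite !mxE.
by congr (_ * _); apply: eq_bigr => l _; rewrite mxE mulr1.
Qed.

(** No mixture of unitary conjugations agrees with [gram_schur] on both a
Hermitian diagonal matrix with distinct entries and the all-ones matrix. *)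
Lemma gram_schur_not_mixed n (n4 : (4 <= n)%N) (d : 'rV[C]_n) l
    (U : 'I_l -> 'M[C]_n) (t : 'I_l -> C) :
  injective (d 0) -> (diag_mx d)^t* = diag_mx d ->
  (forall i, (U i)^t* *m U i = 1%:M) -> (forall i, U i *m (U i)^t* = 1%:M) ->
  (forall i, 0 <= t i) -> \sum_i t i = 1 ->
  \sum_i t i *: (U i *m diag_mx d *m (U i)^t*) = gram_schur (diag_mx d) ->
  \sum_i t i *: (U i *m const_mx 1 *m (U i)^t*) = gram_schur (const_mx 1) ->
  False.
Proof.
move=> dI dH UU1 UU2 t0 t1; rewrite gram_schur_diag => fixd fixJ.
have [i ti] : exists i, t i != 0.
  apply/existsP; apply: contraTT isT; rewrite negb_exists => /forallP h.
  have := t1; rewrite big1 => [/eqP|i _]; first by rewrite eq_sym oner_eq0.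
  by apply/eqP; rewrite -[_ == _]negbK h.
have Uoff j k : j != k -> U i j k = 0.
  apply: (commute_diag_mx dI).
  exact: (mixed_unitary_fix_commute dH UU1 t0 t1 fixd).
(* The row sums of [U i] define its value on the all-ones matrix; they are its
   diagonal entries when the weight of [U i] is nonzero. *)
pose x i j := \sum_k U i j k.
have xE j : x i j = U i j j.
  by rewrite /x (big_only1 j) // => k kj _; rewrite Uoff// eq_sym.
have x1 j : x i j * (x i j)^* = 1.
  have /matrixP/(_ j j) := UU2 i.
  rewrite !mxE eqxx (big_only1 j) // => [|k kj _].
    by rewrite !mxE xE.
  by rewrite Uoff ?mul0r// eq_sym.
have gram j k : \sum_i t i * (x i j * (x i k)^*) =
    \sum_(s < 2) frame s j * (frame s k)^*.
  have /matrixP/(_ j k) := fixJ; rewrite summxE gram_schurE mxE mulr1 => <-.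
  by apply: eq_bigr => i' _; rewrite mxE conj_ones_mxE.
pose J := widen_ord n4.
have rel (c : 'I_4 -> C) : (forall s : 'I_2, \sum_j c j * frame s (J j) = 0) ->
    \sum_j c j * x i (J j) = 0.
  move=> h.
  apply: (gram_relation (w := t) (v := fun i j => x i (J j)) t0 _ h) ti => j k.
  exact: gram.
(* The coefficients of the relations 3 v_0 + 4 v_1 = 5 v_2 and
   3 v_0 + 4 i v_1 = 5 v_3 between the vectors of the frame. *)
have r2 := rel (fun j => [:: 3; 4; -5; 0]`_j).
have r3 := rel (fun j => [:: 3; 4 * 'i; 0; -5]`_j).
apply: (@unimodular_345 _ (x i (J ord0)) (x i (J (lift ord0 ord0)))
  (x i (J (lift ord0 (lift ord0 ord0))))
  (x i (J (lift ord0 (lift ord0 (lift ord0 ord0)))))).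
- by split; exact: x1.
- apply/eqP; rewrite -subr_eq0 -r2; last first.
    move=> s; rewrite !big_ord_recl big_ord0 /frame /=.
    by case: ifP => _; field.
  by apply/eqP; rewrite !big_ord_recl big_ord0 /=; ring.
- apply/eqP; rewrite -subr_eq0 -r3; last first.
    move=> s; rewrite !big_ord_recl big_ord0 /frame /=.
    by case: ifP => _; field.
  by apply/eqP; rewrite !big_ord_recl big_ord0 /=; ring.
Qed.

Lemma mixed_unitary_mx n (Phi : bop R 'I_n 'I_n -> bop R 'I_n 'I_n) :
  mixed_unitary Phi -> exists l (U : 'I_l -> 'M[C]_n) (t : 'I_l -> C),
    [/\ forall i, (U i)^t* *m U i = 1%:M, forall i, U i *m (U i)^t* = 1%:M,
        forall i, 0 <= t i, \sum_i t i = 1 &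
        forall B, Phi (op_of_mx B) =
          op_of_mx (\sum_i t i *: (U i *m B *m (U i)^t*))].
Proof.
move=> [l [u [t [uU t01 t1 PhiE]]]].
have uE i : u i = op_of_mx (mx_of_op (u i)) by rewrite mx_of_opK.
exists l, (fun i => mx_of_op (u i)), (fun i => real_complex R (t i)); split.
- by move=> i; have := uU i; rewrite {1}uE => /unitary_op_of_mx[].
- by move=> i; have := uU i; rewrite {1}uE => /unitary_op_of_mx[].
- by move=> i; have /andP[] := t01 i; rewrite -(ler0c (t i)).
- by rewrite -rmorph_sum t1.
- move=> B; rewrite PhiE linear_sum; apply: eq_bigr => i _.
  by rewrite linearZ /= {1 2}uE adj_op_of_mx !op_of_mxM.
Qed.
End Example.

Theorem mainTheorem7 (R : realType) (n k : nat) (n_gt0 : (0 < n)%N) :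
  (4 <= n)%N -> (2 <= k)%N ->
  exists a b : 'I_k -> bop R 'I_n 'I_n,
    [/\ forall i, selfadjoint_op (a i),
        forall i, selfadjoint_op (b i),
        majorized n_gt0 a b &
        ~ exists Phi : bop R 'I_n 'I_n -> bop R 'I_n 'I_n,
            mixed_unitary Phi /\ forall i, Phi (b i) = a i].
Proof.
move=> n4 k2.
pose d : 'rV[CC R]_n := \row_j (j : nat)%:R.
have dI : injective (d 0).
  by move=> i j; rewrite !mxE => /eqP; rewrite eqr_nat => /eqP/val_inj.
have dH : (diag_mx d)^t* = diag_mx d.
  rewrite tr_diag_mx map_diag_mx; congr diag_mx.
  by apply/rowP => j; rewrite !mxE; exact: conjC_nat.
pose B (i : 'I_k) : 'M[CC R]_n :=
  if (i : nat) == 0%N then diag_mx d else const_mx 1.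
have BH i : (B i)^t* = B i.
  by rewrite /B; case: ifP => // _; rewrite trmx_const map_const_mx conjC1.
have aE i :
    \sum_(s < 2)
      op_of_mx ((kraus n s)^t*) ** op_of_mx (B i) ** op_of_mx (kraus n s) =
    op_of_mx (gram_schur (B i)).
  by rewrite linear_sum; apply: eq_bigr => s _; rewrite !op_of_mxM.
exists (fun i =>
  \sum_(s < 2)
    op_of_mx ((kraus n s)^t*) ** op_of_mx (B i) ** op_of_mx (kraus n s)).
exists (fun i => op_of_mx (B i)); split.
- by move=> i; rewrite aE; exact/selfadjoint_op_of_mx/gram_schur_herm.
- by move=> i; exact: selfadjoint_op_of_mx.
- exact: (@majorized_channel R k n n_gt0 2 (kraus n) (fun i => op_of_mx (B i))
    (kraus_unital n) (kraus_tracial n)).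
- move=> [Phi [/mixed_unitary_mx[l [U [t [U1 U2 t0 t1 PhiE]]]] Phib]].
  have mixB i : \sum_j t j *: (U j *m B i *m (U j)^t*) = gram_schur (B i).
    by apply: (can_inj (@op_of_mxK R n n)); rewrite -PhiE Phib aE.
  apply: (gram_schur_not_mixed n4 dI dH U1 U2 t0 t1).
    exact: (mixB (Ordinal (ltnW k2))).
  exact: (mixB (Ordinal k2)).
Qed.
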